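(* $VC(H^{n,s})\lesssim s\log(n/s)$; that is, there is an absolute constant $C>0$ such that $$VC(H^{n,s})\le C\, s\log(n/s),$$ where $H^{n,s}=\{H_x : x\in\mathbb{S}^{n-1}_s\}$ is the class of hemispheres of $\mathbb{S}^{n-1}$ associated to $s$-sparse unit vectors.
   Context: Here $n$ is the ambient dimension and $s$ is the sparsity level (positive integers). $\mathbb{S}^{n-1}$ is the Euclidean unit sphere of $\mathbb{R}^n$. A vector $x=(x^1,\dots,x^n)\in\mathbb{R}^n$ is $s$-sparse if at most $s$ of its coordinates are nonzero; $\mathbb{S}^{n-1}_s$ is the set of $s$-sparse vectors in $\mathbb{S}^{n-1}$. For $x\in\mathbb{S}^{n-1}$, $H_x=\{p\in\mathbb{S}^{n-1}:\langle p,x\rangle>0\}$. For a class $\mathcal{C}$ of subsets of a set $X$, $\mathcal{C}$ shatters a finite set $B\subset X$ if every subset of $B$ has the form $B\cap C$ with $C\in\mathcal{C}$; the Vapnik-Chervonenkis dimension $VC(\mathcal{C})$ is the largest cardinality of a finite set shattered by $\mathcal{C}$ (and $\infty$ if there is no largest one). The notation $a\lesssim b$ means that there is an absolute constant $C>0$ such that $a\le Cb$. $\log$ is the natural logarithm.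
   Formalization: The bound C s log(n/s) is proved for n ≥ 2s; for n < 2s it is replaced by VC ≤ C s, because as stated it fails when s is near n (for s = n the right side is 0 while VC(H^{n,n}) = n). *)

(* Defs.v *)
From HB Require Import structures.
From mathcomp Require Import all_boot all_order all_algebra.
From mathcomp Require Import all_classical all_reals all_analysis.

Set Implicit Arguments.
Unset Strict Implicit.
Unset Printing Implicit Defensive.

Import Order.TTheory GRing.Theory Num.Theory.

Local Open Scope classical_set_scope.
Local Open Scope ring_scope.

Section VapnikChervonenkis.
Variable T : Type.

Definition shatters (C : set (set T)) (B : set T) : Prop :=
  forall A : set T, A `<=` B -> exists2 D : set T, C D & A = B `&` D.

(* VC dimension of a class C of subsets of X. A supremum of natural numbers
   taken in the extended reals: the largest size of a shattered finite set when
   there is one, +oo when these sizes are unbounded. *)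
Definition VCdim (R : realType) (X : set T) (C : set (set T)) : \bar R :=
  ereal_sup [set k%:R%:E | k in
    [set k : nat | exists B : set T,
       [/\ B `<=` X, (B #= `I_k)%card & shatters C B]]].

End VapnikChervonenkis.

Section SparseHemispheres.
Variables (R : realType) (n : nat).

Definition dotp (x y : 'rV[R]_n) : R := \sum_(i < n) x 0 i * y 0 i.

(* The library norm `|x| on 'rV[R]_n is the sup norm, hence this one. *)
Definition enorm (x : 'rV[R]_n) : R := Num.sqrt (dotp x x).

Definition sphere : set 'rV[R]_n := [set x | enorm x = 1].

Definition sparse (s : nat) (x : 'rV[R]_n) : Prop :=
  (#|[pred i : 'I_n | x 0%R i != 0%R]| <= s)%N.

Definition sparse_sphere (s : nat) : set 'rV[R]_n :=
  [set x | sphere x /\ sparse s x].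

Definition hemisphere (x : 'rV[R]_n) : set 'rV[R]_n :=
  [set p | sphere p /\ 0 < dotp p x].

Definition sparse_hemispheres (s : nat) : set (set 'rV[R]_n) :=
  [set hemisphere x | x in sparse_sphere s].

End SparseHemispheres.

Arguments sphere : clear implicits.
Arguments sparse_sphere : clear implicits.
Arguments sparse_hemispheres : clear implicits.

(* Main.v *)
Require Import Defs.
From mathcomp Require Import all_boot all_order all_algebra.
From mathcomp Require Import all_classical all_reals all_analysis.
From mathcomp Require Import zify ring lra.
Import Order.TTheory GRing.Theory Num.Theory.
Local Open Scope classical_set_scope.
Local Open Scope ring_scope.

(* A support S of size at most s cuts out of k points a family of subsets that
   shatters only sets of size at most s, because more than s vectors of R^S are
   linearly dependent. By Pajor's lemma this family has at most N(k, s) members,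
   where N(m, s) is the number of subsets of size at most s of an m-set. A union
   bound over the supports turns shattering into 2^k <= N(n, s) N(k, s), and
   N(m, s) <= (e m / s)^s gives k <= 20 s ln(n / s). *)

(** * Shattering by finite families of sets *)

Section Pajor.
Context {T : finType}.
Implicit Types (F G : {set {set T}}) (A S : {set T}).

Definition traces F S : bool :=
  [forall A : {set T}, (A \subset S) ==> [exists D in F, A == S :&: D]].

Definition shattered F : {set {set T}} := finset (traces F).

Lemma tracesP F S :
  reflect (forall A, A \subset S -> exists2 D, D \in F & A = S :&: D)
          (traces F S).
Proof.
apply: (iffP forallP) => [H A AS | H A].
  by have /implyP/(_ AS)/exists_inP[D DF /eqP] := H A; exists D.
by apply/implyP => /H[D DF ->]; apply/exists_inP; exists D.
Qed.

Lemma shatteredS F G : F \subset G -> shattered F \subset shattered G.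
Proof.
move=> /fintype.subsetP FG; apply/fintype.subsetP => S; rewrite !inE => /tracesP H.
by apply/tracesP => A /H[D /FG DG ->]; exists D.
Qed.

(** Pajor's lemma, by induction on [#|F|]: split [F] by membership of a point [x]. A set shattered
    by both halves is counted twice, and adding [x] to it yields a second set shattered by [F]. *)
Lemma leq_card_shattered F : (#|F| <= #|shattered F|)%N.
Proof.
have [m] := ubnP #|F|; elim: m F => // m IHm F ltF.
have [F1 | F1] := leqP #|F| 1.
  have [->|[A AF]] := set_0Vmem F; first by rewrite cards0.
  apply: (leq_trans F1); rewrite card_gt0; apply/set0Pn; exists finset.set0.
  rewrite inE; apply/tracesP => B; rewrite finset.subset0 => /eqP ->.
  by exists A => //; rewrite finset.set0I.
have /card_gt1P[A [B [AF BF AB]]] := F1.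
have [x xAB] : exists x, (x \in A) != (x \in B).
  apply/existsP; rewrite -negb_forall; apply: contra AB => /forallP H.
  by apply/eqP/finset.setP => x; apply/eqP/H.
(* [A] and [B] differ at [x], so both halves are nonempty and therefore smaller than [F]. *)
pose F0 := [set D in F | x \notin D]%SET.
pose Fx := [set D in F | x \in D]%SET.
have F0F : F0 \subset F by apply/fintype.subsetP => D; rewrite inE => /andP[].
have F1F : Fx \subset F by apply/fintype.subsetP => D; rewrite inE => /andP[].
have cardF : (#|F0| + #|Fx| = #|F|)%N.
  rewrite -(cardsID [set D : {set T} | x \in D]%SET F) addnC.
  by congr (_ + _)%N; apply: eq_card => D; rewrite !inE // andbC.
have [F0pos F1pos] : (0 < #|F0| /\ 0 < #|Fx|)%N.
  rewrite !card_gt0; case xA: (x \in A) xAB; case xB: (x \in B) => // _.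
    by split; apply/set0Pn; [exists B|exists A]; rewrite inE ?AF ?BF ?xA ?xB.
  by split; apply/set0Pn; [exists A|exists B]; rewrite inE ?AF ?BF ?xA ?xB.
have le0 : (#|F0| <= #|shattered F0|)%N.
  by apply: IHm; lia.
have le1 : (#|Fx| <= #|shattered Fx|)%N by apply: IHm; lia.
rewrite -cardF (leq_trans (leq_add le0 le1)) // -cardsUI.
set U := _ :|: _; set I := _ :&: _.
(* Within each half all members agree at [x], so a set containing [x] is shattered by neither. Hence
   the sets [x |: S] below are new. *)
have xU S : S \in U -> x \notin S.
  rewrite !inE => /orP[] /tracesP H; apply/negP => xS.
    have [D] := H S (subxx _); rewrite inE => /andP[_ xD] E.
    by move: xS; rewrite E inE (negbTE xD) andbF.
  have [D] := H finset.set0 (finset.sub0set _); rewrite inE => /andP[_ xD] E.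
  by have := finset.in_set0 x; rewrite E inE xS xD.
have IU S : S \in I -> S \in U by rewrite !inE => /andP[->].
have injx : {in I &, injective (fun S => x |: S)}.
  by move=> S S' /IU/xU xS /IU/xU xS' E; rewrite -(setU1K xS) E setU1K.
rewrite -(card_in_imset injx) -cardsUI [X in (_ + X)%N]eq_card0 ?addn0; last first.
  move=> S; apply/negP => /finset.setIP[/xU xS /imsetP[S' _ E]].
  by move: xS; rewrite E setU11.
apply: subset_leq_card; rewrite !finset.subUset !shatteredS //=.
apply/fintype.subsetP => _ /imsetP[S SI ->].
have xS := xU _ (IU _ SI); move: SI; rewrite !inE => /andP[/tracesP H0 /tracesP H1].
apply/tracesP => C CS; have CxS : C :\ x \subset S by rewrite subDset.
(* Membership of [x] in [C] decides which half supplies the member that cuts out [C]. *)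
have [xC | xC] := boolP (x \in C).
  have [D] := H1 _ CxS; rewrite inE => /andP[DF xD] E; exists D => //.
  rewrite -(finset.setD1K xC) E finset.setIUl; congr (_ :|: _).
  by apply/esym/finset.setIidPl; rewrite finset.sub1set.
have [D] := H0 _ CxS; rewrite inE => /andP[DF xD] E; exists D => //.
rewrite finset.setIUl -E (_ : [set x]%SET :&: D = finset.set0).
  apply/finset.setP => y; rewrite !inE; case: eqP => // ->.
  by rewrite (negbTE xC).
by apply/finset.setP => y; rewrite !inE; case: eqP => // ->; rewrite (negbTE xD).
Qed.

End Pajor.

Definition small_sets (m s : nat) : {set {set 'I_m}} :=
  [set A : {set 'I_m} | (#|A| <= s)%N]%SET.

Definition few (m s : nat) : nat := #|small_sets m s|.

(** * Sign patterns of sparse vectors on [k] points *)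

Section Dichotomies.
Context {R : realType} {n k : nat}.
Variable p : 'I_k -> 'rV[R]_n.

Definition cuts (A : {set 'I_k}) (x : 'rV[R]_n) : Prop :=
  forall i, (i \in A) = (0 < dotp (p i) x).

Definition dichotomies (S : {set 'I_n}) : {set {set 'I_k}} :=
  finset (fun A =>
    `[< exists2 x : 'rV[R]_n, (forall j, j \notin S -> x 0 j = 0) & cuts A x >]).

(* A linear relation between the restrictions of the p i to S, i \in I, with
   coefficients a of which one is positive forbids cutting out of I exactly the
   indices of positive coefficients. *)
Lemma card_traces_dichotomies (S : {set 'I_n}) (I : {set 'I_k}) :
  traces (dichotomies S) I -> (#|I| <= #|S|)%N.
Proof.
move=> /tracesP shI; rewrite leqNgt; apply/negP => ltSI.
pose M := \matrix_(i < #|I|, j < #|S|) p (enum_val i) 0 (enum_val j).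
have [v v0 vM] : exists2 v : 'rV_#|I|, v != 0 & v *m M = 0.
  have : kermx M != 0.
    rewrite kermx_eq0 /row_free neq_ltn (leq_ltn_trans _ ltSI) //.
    exact: rank_leq_col.
  by case/rowV0Pn => v /sub_kermxP vM v0; exists v.
(* A nonzero relation without positive coefficients is replaced by its opposite. *)
wlog [i0 vi0] : v v0 vM / exists i, 0 < v 0 i.
  move=> H; have /rV0Pn[i vi] := v0.
  have [vpos | vneg | E] := ltgtP (v 0 i) 0; last by rewrite E eqxx in vi.
    apply: (H (- v)); rewrite ?oppr_eq0 ?mulNmx ?vM ?oppr0 //.
    by exists i; rewrite !mxE oppr_gt0.
  by apply: (H v) => //; exists i.
pose A := [set enum_val i | i in [set i : 'I_#|I| | 0 < v 0 i]%SET]%SET.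
have AI : A \subset I.
  by apply/fintype.subsetP => _ /imsetP[i _ ->]; exact: enum_valP.
have [D] := shI _ AI; rewrite inE => /asboolP[x xS cutD] AD.
have pos i : (0 < v 0 i) = (0 < dotp (p (enum_val i)) x).
  rewrite -cutD; have := congr1 (fun B : {set 'I_k} => enum_val i \in B) AD.
  rewrite /= !inE enum_valP /= => <-; rewrite mem_imset ?inE //.
  exact: enum_val_inj.
have dotpE i : dotp (p i) x = \sum_(j < #|S|) p i 0 (enum_val j) * x 0 (enum_val j).
  rewrite /dotp (bigID (mem S)) /= [X in _ + X]big1; last first.
    by move=> j jS; rewrite xS ?mulr0.
  by rewrite addr0 big_enum_val.
(* The relation makes this sum vanish, yet by [pos] its two factors are positive for the same [i]:
   no term is negative, and the term at [i0] is positive. *)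
have : \sum_i v 0 i * dotp (p (enum_val i)) x = 0.
  under eq_bigr => i _ do rewrite dotpE mulr_sumr.
  rewrite exchange_big /= big1 // => j _.
  have := congr1 (fun B : 'rV_#|S| => B 0 j * x 0 (enum_val j)) vM.
  rewrite /= !mxE mul0r mulr_suml => E; rewrite -[RHS]E.
  by apply: eq_bigr => i _; rewrite mxE mulrA.
apply/eqP; rewrite gt_eqF // (bigD1 i0) //= ltr_pwDl ?mulr_gt0 -?pos //.
apply: sumr_ge0 => i _; have [vi | vi] := ltP 0 (v 0 i).
  by rewrite mulr_ge0 ?ltW // -pos.
by rewrite mulr_le0 // leNgt -pos -leNgt.
Qed.

(** The full support [[set: 'I_n]] admits every vector, so the dependence argument bounds [k] by the
    dimension; this serves the range [n < 2 * s]. *)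
Lemma leq_card_cut (s : nat) :
  (forall A, exists2 x : 'rV[R]_n, sparse s x & cuts A x) -> (k <= n)%N.
Proof.
move=> shp; have := @card_traces_dichotomies [set: 'I_n] [set: 'I_k].
rewrite !cardsT !card_ord; apply; apply/tracesP => A _; exists A.
  rewrite inE; apply/asboolP; have [x _ xA] := shp A.
  by exists x => // j; rewrite finset.in_setT.
by rewrite finset.setTI.
Qed.

Lemma card_cuts (s : nat) :
  (forall A, exists2 x : 'rV[R]_n, sparse s x & cuts A x) ->
  (2 ^ k <= few n s * few k s)%N.
Proof.
move=> shp.
have dichS (S : {set 'I_n}) : (#|S| <= s)%N -> (#|dichotomies S| <= few k s)%N.
  move=> Ss; apply: leq_trans (leq_card_shattered _) (subset_leq_card _).
  apply/fintype.subsetP => I; rewrite !inE => /card_traces_dichotomies IS.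
  exact: leq_trans Ss.
have sum_le : (\sum_(S in small_sets n s) #|dichotomies S| <=
    few n s * few k s)%N.
  by rewrite -sum_nat_const leq_sum // => S; rewrite inE => /dichS.
apply: leq_trans sum_le; rewrite -[k in (2 ^ k)%N]card_ord -cardsT -card_powerset.
apply: (@leq_trans #|(\bigcup_(S in small_sets n s) dichotomies S)%SET|).
  apply/subset_leq_card/fintype.subsetP => A _; have [x xs xA] := shp A.
  apply/bigcupP; exists (finset (fun j => x 0 j != 0)).
    by rewrite inE cardsE.
  rewrite inE; apply/asboolP; exists x => // j.
  by rewrite inE negbK => /eqP.
elim/big_rec2 : _ => [|S m B _ IH]; first by rewrite cards0.
by rewrite (leq_trans (leq_card_setU _ _)) // leq_add2l.
Qed.

End Dichotomies.

(** * Numerical estimates *)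

(* Chernoff: (s / m) ^ s is at most (s / m) ^ #|A| on the sets counted, and the
   latter sums over all A to (1 + s / m) ^ m <= e ^ s. *)
Lemma few_le {R : realType} (m s : nat) : (0 < s <= m)%N ->
  (few m s)%:R <= expR s%:R * (m%:R / s%:R) ^+ s :> R.
Proof.
move=> /andP[s0 sm]; have sR : 0 < s%:R :> R by rewrite ltr0n.
have mR : 0 < m%:R :> R by rewrite ltr0n (leq_trans s0).
pose x : R := s%:R / m%:R.
have x0 : 0 < x by rewrite divr_gt0.
have x1 : x <= 1 by rewrite ler_pdivrMr // mul1r ler_nat.
have -> : m%:R / s%:R = x^-1 by rewrite invf_div.
rewrite exprVn ler_pdivlMr ?exprn_gt0 //.
apply: (@le_trans _ _ (\sum_(A : {set 'I_m}) x ^+ #|A|)).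
  rewrite mulr_natl -sumr_const /=.
  rewrite [leRHS](bigID (mem (small_sets m s))) /=.
  rewrite -[leLHS]addr0 lerD //; last first.
    by rewrite sumr_ge0 // => A _; rewrite exprn_ge0 // ltW.
  apply: ler_sum => A; rewrite inE => As.
  by rewrite ler_wiXn2l // ltW.
have -> : \sum_(A : {set 'I_m}) x ^+ #|A| = (x + 1) ^+ m.
  rewrite -[m in RHS]card_ord -prodr_const (bigA_distr 1) /=.
  by apply: eq_bigr => A _; rewrite -big_mkcond prodr_const.
rewrite (_ : s%:R = m%:R * x); last by rewrite mulrC divfK ?gt_eqF.
by rewrite expRM_natl lerXn2r ?nnegrE ?addr_ge0 ?expR_ge0 ?(ltW x0) // addrC expR_ge1Dx.
Qed.

Lemma ln2_ge {R : realType} : 1 / 2 <= ln 2 :> R.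
Proof.
have := @le_ln1Dx R (- (1 / 2)); rewrite (_ : 1 - 1 / 2 = 2^-1); last by field.
by rewrite lnV ?posrE // => /(_ ltac:(lra)); lra.
Qed.

Lemma lnX_natl {R : realType} (x : R) (m : nat) :
  0 < x -> ln (x ^+ m) = m%:R * ln x.
Proof. by move=> x0; rewrite lnXn // mulr_natl. Qed.

(** With [t = k / s] and [u = n / s], logarithms give [t ln 2 <= 2 + ln u + ln t]. Bounding [ln t]
    by its tangent at 4 and using [1 / 2 <= ln 2 <= ln u] leaves [t / 4 <= 5 ln u], whence the
    constant 20. *)
Lemma card_cuts_le {R : realType} (n k s : nat) : (0 < s)%N -> (2 * s <= n)%N ->
  (2 ^ k <= few n s * few k s)%N -> k%:R <= 20 * (s%:R * ln (n%:R / s%:R)) :> R.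
Proof.
move=> s0 sn le2k; have sR : 0 < s%:R :> R by rewrite ltr0n.
have u2 : 2 <= n%:R / s%:R :> R.
  by rewrite ler_pdivlMr // -natrM ler_nat.
have ln2 := @ln2_ge R.
have lnu : ln 2 <= ln (n%:R / s%:R) :> R.
  by rewrite ler_ln ?posrE // (lt_le_trans _ u2).
set u := n%:R / s%:R in u2 lnu *.
rewrite mulrCA -ler_pdivrMl // mulrC.
(* [few_le] on [k] points requires [s <= k]; otherwise [k / s <= 1 <= 2 ln 2] is enough. *)
have [ks | sk] := leqP k s.
  by rewrite (@le_trans _ _ 1) ?ler_pdivrMr ?mul1r ?ler_nat //; lra.
set t := k%:R / s%:R.
have t0 : 0 < t by rewrite divr_gt0 // ltr0n; lia.
have u0 : 0 < u by lra.
have : (2 : R) ^+ k <= (expR s%:R * u ^+ s) * (expR s%:R * t ^+ s).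
  rewrite -natrX (le_trans (_ : _ <= (few n s * few k s)%:R)) ?ler_nat //.
  by rewrite natrM ler_pM // few_le //; lia.
clearbody u; rewrite -ler_ln ?posrE ?mulr_gt0 ?expR_gt0 ?exprn_gt0 //.
rewrite !lnM ?posrE ?mulr_gt0 ?expR_gt0 ?exprn_gt0 // !expRK !lnX_natl //.
have tk : k%:R = t * s%:R :> R by rewrite divfK ?gt_eqF.
rewrite tk => main.
have {main} : s%:R * (t * ln 2) <= s%:R * (2 + ln u + ln t) :> R by lra.
rewrite ler_pM2l // => main.
(* the tangent of ln at 4 *)
have : ln (t / 4) <= t / 4 - 1.
  by have := @le_ln1Dx R (t / 4 - 1); rewrite subrKC; apply; lra.
rewrite ln_div ?posrE // (_ : 4 = 2 ^+ 2); last by rewrite -natrX.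
rewrite lnX_natl // => lnt.
have : t * (1 / 2) <= t * ln 2 by rewrite ler_pM2l.
by lra.
Qed.

(** * From hemispheres to indexed points, and the final bound *)

Lemma shatters_cuts {R : realType} (n s k : nat) (B : set 'rV[R]_n) :
  B `<=` sphere R n -> (B #= `I_k)%card ->
  shatters (sparse_hemispheres R n s) B ->
  exists p : 'I_k -> 'rV[R]_n,
    forall A, exists2 x : 'rV[R]_n, sparse s x & cuts p A x.
Proof.
move=> Bsph /card_set_bijP[g [_ _ gsurj]] shB.
have /choice[p pP] (i : 'I_k) : exists y, B y /\ g y = i.
  by have [y By gy] := gsurj i (ltn_ord i); exists y.
exists p => A.
have [|D [x [_ xs] <-] E] := shB [set y | B y /\ exists2 i, i \in A & y = p i].
  by move=> y [].
exists x => // i; have [Bpi gpi] := pP i.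
apply/idP/idP => [iA|xpos].
  suff : (B `&` hemisphere x) (p i) by case=> _ [].
  by rewrite -E; split => //; exists i.
have : (B `&` hemisphere x) (p i) by split => //; split => //; exact: Bsph.
(* [g] is a left inverse of [p], so [p i = p j] forces [i = j]. *)
rewrite -E => -[_ [j jA]] /(congr1 g).
by rewrite gpi (pP j).2 => /val_inj ->.
Qed.

(* For n close to s the bound s log(n/s) degenerates (it vanishes at s = n,
   where the VC dimension is n; at s = n - 1 it is about 1, while the VC
   dimension is at least n - 1), so the bound is stated for n >= 2s; in the
   remaining range log(n/s) is replaced by a constant. *)
Theorem theorem2p1 (R : realType) :
  exists2 C : R, 0 < C &
    forall n s : nat, (0 < n)%N -> (0 < s)%N ->
      ((2 * s <= n)%N ->
        (VCdim R (sphere R n) (sparse_hemispheres R n s)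
           <= (C * (s%:R * ln (n%:R / s%:R)))%:E)%E)
      /\
      ((n < 2 * s)%N ->
        (VCdim R (sphere R n) (sparse_hemispheres R n s)
           <= (C * s%:R)%:E)%E).
Proof.
exists 20 => // n s _ s0.
split => ns; apply: ge_ereal_sup => _ [k [B [Bsph Bk shB]] <-]; rewrite lee_fin;
  have [p pcut] := shatters_cuts _ _ _ _ Bsph Bk shB.
  by apply: card_cuts_le => //; exact: card_cuts pcut.
(* Here [k <= n < 2 * s], well below [20 * s]. *)
have kn := leq_card_cut _ _ pcut.
by rewrite -natrM ler_nat; lia.
Qed.
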